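(* Let $M\in\mathbb{R}^{m\times m}$ be nonsymmetric and positive definite, let $A\in\mathbb{R}^{m\times n}$ have full column rank, and let $b\in\mathbb{R}^n$, $b\neq0$. Suppose that the nonsymmetric generalized Golub-Kahan process started from $b$ (described in the context) runs for $n$ steps. Let $(u,p)$ be the solution of $$\begin{bmatrix} M & A\\ A^T & 0\end{bmatrix}\begin{bmatrix}u\\ p\end{bmatrix}=\begin{bmatrix}0\\ b\end{bmatrix},$$ let $1\le k<n$, and let $u_k=V_kz_k$ with $z_k=\beta_1L_k^{-T}B_k^{-T}e_1$ be the $k$-th approximation of $u$, where $e_1$ is the first standard basis vector of $\mathbb{R}^k$. Then the error $e^{(k)}=u-u_k$ of the primal variable at step $k$ satisfies, in the energy norm, $$\|e^{(k)}\|_M=\sqrt{x_{n-k}^T\,L_{n-k}^{-T}\,x_{n-k}},$$ where $x_{n-k}\in\mathbb{R}^{n-k}$ consists of the last $n-k$ entries of $x_n=\beta_1B_n^{-T}e_1\in\mathbb{R}^n$ (here $e_1$ is the first standard basis vector of $\mathbb{R}^n$), and, in this formula, $L_{n-k}\in\mathbb{R}^{(n-k)\times(n-k)}$ denotes the trailing (lower right) diagonal block of $L_n=V_n^TMV_n$, i.e. the block with rows and columns $k+1,\dots,n$.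
   Context: Positive definite means $x^TMx>0$ for all nonzero $x\in\mathbb{R}^m$ (no symmetry required). Write $\|x\|_M=\sqrt{x^TMx}$ (the energy norm) and $\|\cdot\|_2$ for the Euclidean norm. Exact arithmetic is assumed. $X^{-T}$ denotes $(X^{-1})^T$. Nonsymmetric generalized Golub-Kahan process started from $b$: set $\beta_1=\|b\|_2$, $q_1=b/\beta_1$, $w_1=M^{-1}Aq_1$, $\alpha_1=\|w_1\|_M$, $v_1=w_1/\alpha_1$. For $j=2,3,\dots$: with $Q_{j-1}=[q_1,\dots,q_{j-1}]$, set $h_j=Q_{j-1}^TA^Tv_{j-1}=(\theta_{1,j},\dots,\theta_{j-1,j})^T$, $g_j=A^Tv_{j-1}-Q_{j-1}h_j$, $\beta_j=\|g_j\|_2$; if $\beta_j=0$ the process stops; otherwise $q_j=g_j/\beta_j$, $w_j=M^{-1}(Aq_j-\beta_jMv_{j-1})$, $\alpha_j=\|w_j\|_M$, $v_j=w_j/\alpha_j$. ''The process runs for $k$ steps'' means that $\beta_1,\dots,\beta_k$ are all nonzero, so that $q_1,\dots,q_k$ and $v_1,\dots,v_k$ are defined. Matrices (for $1\le k\le n$): $V_k=[v_1,\dots,v_k]\in\mathbb{R}^{m\times k}$, and $L_k=V_k^TMV_k\in\mathbb{R}^{k\times k}$, which is the leading $k\times k$ block of $L_n$. $B_k\in\mathbb{R}^{k\times k}$ is the upper bidiagonal matrix with diagonal $\alpha_1,\dots,\alpha_k$ and superdiagonal $\beta_2,\dots,\beta_k$ (that is, $(B_k)_{j-1,j}=\beta_j$).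 The matrices $B_k$, $L_k$, and the trailing block of $L_n$ appearing in the claim are invertible. The subscript $n-k$ in the claim always refers to the last $n-k$ entries (or the trailing block of that size) of the quantity at step $n$, not to the quantity at step number $n-k$. *)

(* Defs.v *)
From mathcomp Require Import all_boot all_order all_algebra.

Set Implicit Arguments.
Unset Strict Implicit.
Unset Printing Implicit Defensive.

Import Order.TTheory GRing.Theory Num.Theory.
Local Open Scope ring_scope.

(* No symmetry of M is required. *)
Definition posdef (R : rcfType) (m : nat) (M : 'M[R]_m) : Prop :=
  forall x : 'cV[R]_m, x != 0 -> 0 < (x^T *m M *m x) 0 0.

Definition energy_norm (R : rcfType) (m : nat) (M : 'M[R]_m) (x : 'cV[R]_m) : R :=
  Num.sqrt ((x^T *m M *m x) 0 0).

Definition norm2 (R : rcfType) (n : nat) (x : 'cV[R]_n) : R :=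
  Num.sqrt (\sum_i x i 0 ^+ 2).

(* X^{-T}; [invmx X] is [X] itself when X is singular. *)
Definition invtrmx (R : rcfType) (k : nat) (X : 'M[R]_k) : 'M[R]_k := (invmx X)^T.

Definition std_e1 (R : rcfType) (k : nat) : 'cV[R]_k :=
  \col_i ((i : nat) == 0%N)%:R.

(* The sequences produced by the process are indexed from 1, as on paper, and
   their value at 0 is never used: column i of [cols k x], counted from 0, is
   x (i + 1). *)
Definition cols (R : rcfType) (p k : nat) (x : nat -> 'cV[R]_p) : 'M[R]_(p, k) :=
  \matrix_(i, j) x j.+1 i 0.

Section GolubKahan.
Variables (R : rcfType) (m n : nat).
Variables (M : 'M[R]_m) (A : 'M[R]_(m, n)) (b : 'cV[R]_n).
Variables (alpha beta : nat -> R) (q : nat -> 'cV[R]_n) (v : nat -> 'cV[R]_m).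

Definition gk_h (j : nat) : 'cV[R]_(j.-1) := (cols j.-1 q)^T *m (A^T *m v j.-1).

Definition gk_g (j : nat) : 'cV[R]_n := A^T *m v j.-1 - cols j.-1 q *m gk_h j.

Definition gk_w (j : nat) : 'cV[R]_m :=
  if j == 1%N then invmx M *m (A *m q 1%N)
  else invmx M *m (A *m q j - beta j *: (M *m v j.-1)).

(* The process started from b runs for k steps, and its coefficients and
   vectors are alpha_j, beta_j, q_j, v_j for 1 <= j <= k. *)
Record gk_runs (k : nat) : Prop := GKRuns {
  gk_beta1 : beta 1%N = norm2 b;
  gk_q1 : q 1%N = (beta 1%N)^-1 *: b;
  gk_beta : forall j, (2 <= j <= k)%N -> beta j = norm2 (gk_g j);
  gk_q : forall j, (2 <= j <= k)%N -> q j = (beta j)^-1 *: gk_g j;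
  gk_alpha : forall j, (1 <= j <= k)%N -> alpha j = energy_norm M (gk_w j);
  gk_v : forall j, (1 <= j <= k)%N -> v j = (alpha j)^-1 *: gk_w j;
  gk_beta_neq0 : forall j, (1 <= j <= k)%N -> beta j != 0
}.

Definition Vmx (k : nat) : 'M[R]_(m, k) := cols k v.

Definition Lmx (k : nat) : 'M[R]_k := (Vmx k)^T *m M *m Vmx k.

Definition Bmx (k : nat) : 'M[R]_k :=
  \matrix_(i, j) (if i == j then alpha j.+1
                  else if i.+1 == j :> nat then beta j.+1 else 0).

Definition gk_x (k : nat) : 'cV[R]_k :=
  beta 1%N *: (invtrmx (Bmx k) *m std_e1 R k).

Definition gk_z (k : nat) : 'cV[R]_k :=
  beta 1%N *: (invtrmx (Lmx k) *m invtrmx (Bmx k) *m std_e1 R k).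

Definition gk_u (k : nat) : 'cV[R]_m := Vmx k *m gk_z k.

End GolubKahan.

Lemma tail_ord_subproof (n k : nat) (i : 'I_(n - k)) : (k + i < n)%N.
Proof. by rewrite -ltn_subRL. Qed.

Definition tail_ord (n k : nat) (i : 'I_(n - k)) : 'I_n :=
  Ordinal (tail_ord_subproof i).

Definition tail_col (R : rcfType) (n k : nat) (x : 'cV[R]_n) : 'cV[R]_(n - k) :=
  rowsub (@tail_ord n k) x.

Definition tail_block (R : rcfType) (n k : nat) (X : 'M[R]_n) : 'M[R]_(n - k) :=
  mxsub (@tail_ord n k) (@tail_ord n k) X.

(* Main.v *)
Require Import Defs.
From mathcomp Require Import all_boot all_order all_algebra reals.

Set Implicit Arguments.
Unset Strict Implicit.
Unset Printing Implicit Defensive.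

Import Order.TTheory GRing.Theory Num.Theory.
Local Open Scope ring_scope.

(** Write Q, V, B, L for the matrices after all n steps.  The recurrences for
    w_j say A Q = M V B ([gk_AQ]), and the q_j are orthonormal ([gk_q_dot]), so
    that Q is square orthogonal.  The step producing q_{i+1} puts A^T v_i in the
    span of q_1, ..., q_{i+1}, with last coefficient beta_{i+1}.  Reading the
    entries of V^T A Q = L B to the right of the diagonal, together with
    L_ii = 1, gives by induction along each row that L is lower triangular
    ([gk_v_Morth], [gk_L_trig]); this replaces the M-orthonormality of the v_j
    that holds for symmetric M.  No alpha_j vanishes, because A Q = M V B and
    A Q has rank n, so that B is invertible ([gk_B_unitmx]).

    Eliminating p in the saddle point system gives u = V c with L^T c = x_n
    ([gk_primal]).  The leading blocks of L and B are the matrices of step k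
    and B^T is lower triangular, so the first k entries of x_n form the vector
    x_k of step k, and L_k^T z_k = x_k.  Let d be c minus z_k padded with zeros, so that the error is V d.
    As L^T is upper triangular, L^T d is x_n with its first k entries replaced
    by 0, and the last n - k entries of d solve the system with the transposed
    trailing block of L and right-hand side x_{n-k}.  Therefore
    d^T L d = (L^T d)^T d only involves these trailing entries, and equals
    the quadratic form of the theorem ([tail_energy]).

    The splitting of indices into the first k and the last n - k is expressed by
    multiplication with selection matrices H and P satisfying
    H^T H + P^T P = 1 and P P^T = 1, so that no dimension casts occur. *)

(** * Energy norm and Euclidean norm *)

Lemma posdef_energy_ge0 (R : rcfType) (m : nat) (M : 'M[R]_m) (x : 'cV[R]_m) :
  posdef M -> 0 <= (x^T *m M *m x) 0 0.
Proof.
move=> hM; have [->|x0] := eqVneq x 0; first by rewrite mulmx0 mxE.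
by rewrite ltW // hM.
Qed.

Lemma energy_norm_sqr (R : rcfType) (m : nat) (M : 'M[R]_m) (x : 'cV[R]_m) :
  posdef M -> energy_norm M x ^+ 2 = (x^T *m M *m x) 0 0.
Proof. by move=> hM; rewrite sqr_sqrtr // posdef_energy_ge0. Qed.

Lemma energy_norm_eq0 (R : rcfType) (m : nat) (M : 'M[R]_m) (x : 'cV[R]_m) :
  posdef M -> energy_norm M x = 0 -> x = 0.
Proof.
move=> hM x0; apply/eqP/negPn/negP => /hM.
by rewrite -energy_norm_sqr // x0 expr0n ltxx.
Qed.

Lemma posdef_unitmx (R : rcfType) (m : nat) (M : 'M[R]_m) :
  posdef M -> M \in unitmx.
Proof.
move=> hM; rewrite unitmxE unitfE; apply/negP => /det0P [x x0 xM].
have /hM : x^T != 0 by rewrite trmx_eq0.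
by rewrite trmxK xM mul0mx mxE ltxx.
Qed.

Lemma norm2_sqr (R : rcfType) (n : nat) (x : 'cV[R]_n) :
  norm2 x ^+ 2 = (x^T *m x) 0 0.
Proof.
rewrite sqr_sqrtr; last by apply: sumr_ge0 => i _; apply: sqr_ge0.
by rewrite mxE; apply: eq_bigr => i _; rewrite mxE expr2.
Qed.

Lemma dot_normalized (R : rcfType) (n : nat) (x : 'cV[R]_n) :
  norm2 x != 0 ->
  (((norm2 x)^-1 *: x)^T *m ((norm2 x)^-1 *: x)) 0 0 = 1.
Proof.
move=> x0; rewrite [(_ *: _)^T]linearZ /= -scalemxAl -scalemxAr !mxE.
by move: (norm2_sqr x); rewrite mxE => <-; rewrite expr2 mulKf // mulVf.
Qed.

Lemma dotC (R : comNzRingType) (n : nat) (x y : 'cV[R]_n) :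
  (x^T *m y) 0 0 = (y^T *m x) 0 0.
Proof. by rewrite -[x^T *m y]trmxK mxE trmx_mul trmxK. Qed.

(** * Triangular matrices and matrices given by their columns *)

Lemma trig_unitmx (F : fieldType) (n : nat) (X : 'M[F]_n) :
  is_trig_mx X -> (forall i, X i i != 0) -> X \in unitmx.
Proof.
move=> trX X0; rewrite unitmxE unitfE det_trig //.
by apply/prodf_neq0 => i _; apply: X0.
Qed.

Lemma trig_unitmx_diag (F : fieldType) (n : nat) (X : 'M[F]_n) (i : 'I_n) :
  is_trig_mx X -> X \in unitmx -> X i i != 0.
Proof. by move=> trX; rewrite unitmxE unitfE det_trig // => /prodf_neq0; apply. Qed.

Lemma mulmx_cols (R : rcfType) (m p k : nat) (X : 'M[R]_(m, p))
    (x : nat -> 'cV[R]_p) :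
  X *m cols k x = cols k (fun j => X *m x j).
Proof. by apply/matrixP => i j; rewrite !mxE; apply: eq_bigr => l _; rewrite mxE. Qed.

Lemma tr_cols_mul (R : rcfType) (p k : nat) (x : nat -> 'cV[R]_p)
    (y : 'cV[R]_p) (i : 'I_k) :
  ((cols k x)^T *m y) i 0 = ((x i.+1)^T *m y) 0 0.
Proof. by rewrite !mxE; apply: eq_bigr => l _; rewrite !mxE. Qed.

Lemma tr_cols_mul_cols (R : rcfType) (p k : nat) (x y : nat -> 'cV[R]_p)
    (i j : 'I_k) :
  ((cols k x)^T *m cols k y) i j = ((x i.+1)^T *m y j.+1) 0 0.
Proof. by rewrite !mxE; apply: eq_bigr => l _; rewrite !mxE. Qed.

Lemma mul_cols_Bmx (R : rcfType) (p n : nat) (alpha beta : nat -> R)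
    (y : nat -> 'cV[R]_p) (i : 'I_p) (j : 'I_n) :
  (cols n y *m Bmx alpha beta n) i j =
  alpha j.+1 * y j.+1 i 0 + (if j == 0 :> nat then 0 else beta j.+1 * y j i 0).
Proof.
rewrite mxE (bigD1 j) //= !mxE eqxx mulrC; congr (_ + _).
case: eqP => [j0|/eqP j0].
  apply: big1 => l lj; rewrite !mxE (negPf lj).
  by rewrite j0 /= mulr0.
have ltj : (j.-1 < n)%N by rewrite (leq_ltn_trans (leq_pred j)).
have Sj : (j.-1).+1 = j by rewrite prednK // lt0n.
have j'j : Ordinal ltj != j by rewrite -val_eqE /= -{2}Sj ltn_eqF.
rewrite (bigD1 (Ordinal ltj)) //= !mxE /= Sj eqxx (negPf j'j).
rewrite big1 ?addr0 1?mulrC // => l /andP [lj lj'].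
rewrite !mxE (negPf lj) ifN ?mulr0 //.
apply/eqP => e; move/eqP: lj'; apply; apply: val_inj => /=.
by rewrite -e.
Qed.

Lemma Bmx_tr_trig (R : rcfType) (n : nat) (alpha beta : nat -> R) :
  is_trig_mx (Bmx alpha beta n)^T.
Proof.
apply/is_trig_mxP => i j ij; rewrite !mxE -val_eqE /= gtn_eqF //.
by rewrite gtn_eqF // ltnW.
Qed.

(** * The vectors of the process *)

Section Process.

Context {R : rcfType} {m n : nat} {M : 'M[R]_m} {A : 'M[R]_(m, n)} {b : 'cV[R]_n}.
Context {alpha beta : nat -> R} {q : nat -> 'cV[R]_n} {v : nat -> 'cV[R]_m}.
Context {k : nat} (hM : posdef M) (hrun : gk_runs M A b alpha beta q v k).

Lemma gk_q_normed (j : nat) : (1 <= j <= k)%N -> ((q j)^T *m q j) 0 0 = 1.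
Proof.
move=> jk; have b0 := gk_beta_neq0 hrun jk; case/andP: jk => j1 jk.
move: j1 b0; rewrite leq_eqVlt => /orP [/eqP <-|j2].
  by rewrite (gk_q1 hrun) (gk_beta1 hrun); apply: dot_normalized.
by rewrite (gk_q hrun) ?j2 // (gk_beta hrun) ?j2 //; apply: dot_normalized.
Qed.

(** Gram-Schmidt: g_j is A^T v_{j-1} minus its projection on the span of the
    earlier q_i, because these are orthonormal by induction. *)
Lemma gk_q_orth (i j : nat) : (1 <= i < j)%N -> (j <= k)%N ->
  ((q i)^T *m q j) 0 0 = 0.
Proof.
elim/ltn_ind: j i => j IH i /andP [i1 ij] jk.
have j2 : (1 < j)%N by apply: leq_trans ij.
have orth : (cols j.-1 q)^T *m cols j.-1 q = 1%:M.
  apply/matrixP => a c; rewrite tr_cols_mul_cols [RHS]mxE.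
  have lt (d : 'I_j.-1) : (d.+1 < j)%N by rewrite -ltn_predRL.
  have le (d : 'I_j.-1) : (d.+1 <= k)%N by apply: leq_trans jk; apply: ltnW.
  case: (ltngtP a c) => [ac|ca|/val_inj ->].
  - by rewrite IH //= -val_eqE /= ltn_eqF.
  - by rewrite dotC IH //= -val_eqE /= gtn_eqF.
  - by rewrite gk_q_normed ?le // eqxx.
have lti : (i.-1 < j.-1)%N by rewrite -ltnS !prednK // ltnW.
have := tr_cols_mul q (q j) (Ordinal lti).
rewrite /= prednK // => <-.
rewrite (gk_q hrun) ?j2 // -scalemxAr /gk_g /gk_h mulmxBr.
by rewrite [(cols _ _)^T *m (cols _ _ *m _)]mulmxA orth mul1mx subrr !mxE mulr0.
Qed.

Lemma gk_q_dot (i j : nat) : (1 <= i <= k)%N -> (1 <= j <= k)%N ->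
  ((q i)^T *m q j) 0 0 = (i == j)%:R.
Proof.
move=> /andP [i1 ik] /andP [j1 jk]; case: (ltngtP i j) => [ij|ji|<-].
- by rewrite gk_q_orth ?i1.
- by rewrite dotC gk_q_orth ?j1.
- by rewrite gk_q_normed ?i1.
Qed.

(** This holds even if alpha_j = 0, since then w_j = 0 by definiteness.  Thus
    A Q = M V B is available before the alpha_j are known to be nonzero, and
    can be used to prove that they are. *)
Lemma gk_scale_v (j : nat) : (1 <= j <= k)%N ->
  alpha j *: v j = gk_w M A beta q v j.
Proof.
move=> jk; rewrite (gk_v hrun) // scalerA.
have [a0|a0] := eqVneq (alpha j) 0; last by rewrite mulfV // scale1r.
rewrite a0 mul0r scale0r; apply/esym/(energy_norm_eq0 hM).
by rewrite -(gk_alpha hrun).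
Qed.

Lemma gk_A_q (j : nat) : (1 <= j <= k)%N ->
  A *m q j = alpha j *: (M *m v j) +
             (if j == 1%N then 0 else beta j *: (M *m v j.-1)).
Proof.
move=> jk; rewrite scalemxAr gk_scale_v // /gk_w; case: eqP => [->|_];
  rewrite mulKVmx ?posdef_unitmx //; first by rewrite addr0.
by rewrite subrK.
Qed.

Lemma gk_AQ : A *m cols k q = M *m Vmx v k *m Bmx alpha beta k.
Proof.
apply/matrixP => i j; rewrite !mulmx_cols mul_cols_Bmx mxE gk_A_q ?ltn_ord //.
by rewrite eqSS; case: eqP => _; rewrite !mxE.
Qed.

(** V^T A Q is lower Hessenberg with superdiagonal beta_2, beta_3, ...: the
    definition of q_{i+1} writes A^T v_i as beta_{i+1} q_{i+1} plus a combination
    of q_1, ..., q_i, and the q_j are orthonormal. *)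
Lemma gk_v_A_q (i j : nat) : (1 <= i)%N -> (i < j <= k)%N ->
  ((v i)^T *m (A *m q j)) 0 0 = if j == i.+1 then beta j else 0.
Proof.
move=> i1 /andP [ij jk].
have iS : (1 < i.+1 <= k)%N by rewrite ltnS i1 (leq_trans ij).
have Av : A^T *m v i = beta i.+1 *: q i.+1 + cols i q *m gk_h A q v i.+1.
  rewrite (gk_q hrun) // scalerA mulfV ?scale1r ?subrK //.
  by apply: (gk_beta_neq0 hrun); case/andP: iS => /ltnW -> ->.
rewrite mulmxA -[_ *m A]trmxK trmx_mul trmxK Av linearD /= [(_ *: _)^T]linearZ /=.
rewrite mulmxDl -scalemxAl.
have orth : (cols i q)^T *m q j = 0.
  apply/matrixP => a c; rewrite (ord1 c) tr_cols_mul gk_q_orth ?mxE //=.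
  by rewrite (leq_ltn_trans _ ij).
rewrite trmx_mul -mulmxA orth mulmx0 addr0 mxE gk_q_dot ?jk ?(leq_trans _ ij) //.
  by rewrite eq_sym; case: eqP => [->|_]; rewrite ?mulr1 ?mulr0.
by case/andP: iS => /ltnW ->.
Qed.

Lemma gk_v_normed (j : nat) : (1 <= j <= k)%N -> alpha j != 0 ->
  ((v j)^T *m M *m v j) 0 0 = 1.
Proof.
move=> jk a0; rewrite (gk_v hrun) // [(_ *: _)^T]linearZ /= -!scalemxAl -scalemxAr !mxE.
have := energy_norm_sqr (gk_w M A beta q v j) hM.
rewrite mxE => <-; rewrite -(gk_alpha hrun) // expr2 mulKf //.
by rewrite mulVf.
Qed.

(** One-sided M-orthogonality, by induction on j.  Taking the product of v_i with
    A q_{j+1} = alpha_{j+1} M v_{j+1} + beta_{j+1} M v_j, the left side is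
    beta_{i+1} if j = i and 0 if j > i.  The last term has the same value, by
    v_i^T M v_i = 1 in the first case and by induction in the second. *)
Lemma gk_v_Morth (i j : nat) : (forall l, (1 <= l <= k)%N -> alpha l != 0) ->
  (1 <= i)%N -> (i < j <= k)%N -> ((v i)^T *m M *m v j) 0 0 = 0.
Proof.
move=> a0 i1; elim: j => [|j IH] /andP [//]; rewrite ltnS => ij jk.
have j1 : (1 <= j)%N by apply: leq_trans ij.
have aj : alpha j.+1 != 0 by apply: a0.
apply: (mulfI aj); rewrite mulr0.
have := @gk_v_A_q i j.+1 i1; rewrite ltnS ij jk => /(_ isT).
rewrite gk_A_q // !eqSS (gtn_eqF j1) mulmxDr -!scalemxAr !mulmxA !mxE /=.
have [<-|ji] := eqVneq j i.
  have jk' : (0 < j <= k)%N by rewrite j1 ltnW.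
  have := gk_v_normed jk' (a0 _ jk'); rewrite mxE => ->.
  by rewrite mulr1 => e; apply: (addIr (beta j.+1)); rewrite e add0r.
have ij' : (i < j)%N by rewrite ltn_neqAle eq_sym ji.
move: IH; rewrite ij' ltnW // => /(_ isT); rewrite mxE => ->.
by rewrite mulr0 addr0.
Qed.

End Process.

(** * A run of length n *)

Section FullRun.

Context {R : rcfType} {m n : nat} {M : 'M[R]_m} {A : 'M[R]_(m, n)} {b : 'cV[R]_n}.
Context {alpha beta : nat -> R} {q : nat -> 'cV[R]_n} {v : nat -> 'cV[R]_m}.
Context (hM : posdef M) (hA : \rank A = n).
Context (hrun : gk_runs M A b alpha beta q v n).

Lemma gk_Q_orthogonal : (cols n q)^T *m cols n q = 1%:M.
Proof.
apply/matrixP => i j.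
by rewrite tr_cols_mul_cols (gk_q_dot hrun) ?ltn_ord // mxE eqSS.
Qed.

(** A Q = (M V) B has rank n, which is therefore at most the rank of B. *)
Lemma gk_B_unitmx : Bmx alpha beta n \in unitmx.
Proof.
have Qu : cols n q \in unitmx.
  by case/mulmx1_unit: gk_Q_orthogonal.
rewrite -row_free_unit /row_free eqn_leq rank_leq_row -{1}hA.
rewrite -(mxrankMfree A (B := cols n q)) ?row_free_unit //.
by rewrite (gk_AQ hM hrun) mxrankM_maxr.
Qed.

Lemma gk_alpha_neq0 (j : nat) : (1 <= j <= n)%N -> alpha j != 0.
Proof.
case: j => // j /= jn; have := trig_unitmx_diag (Ordinal jn) (Bmx_tr_trig n alpha beta).
by rewrite unitmx_tr gk_B_unitmx !mxE eqxx; apply.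
Qed.

Lemma Lmx_entry (k : nat) (i j : 'I_k) :
  Lmx M v k i j = ((v i.+1)^T *m M *m v j.+1) 0 0.
Proof. by rewrite /Lmx /Vmx -mulmxA mulmx_cols tr_cols_mul_cols mulmxA. Qed.

Lemma gk_L_diag (i : 'I_n) : Lmx M v n i i = 1.
Proof. by rewrite Lmx_entry (gk_v_normed hM hrun) ?gk_alpha_neq0 ?ltn_ord. Qed.

Lemma gk_L_trig : is_trig_mx (Lmx M v n).
Proof.
apply/is_trig_mxP => i j ij.
by rewrite Lmx_entry (gk_v_Morth hM hrun gk_alpha_neq0) // ltnS ij ltn_ord.
Qed.

Lemma tr_Bmx_gk_x :
  (Bmx alpha beta n)^T *m gk_x alpha beta n = beta 1%N *: std_e1 R n.
Proof.
rewrite /gk_x -scalemxAr mulmxA /invtrmx trmx_inv mulmxV ?mul1mx //.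
by rewrite unitmx_tr gk_B_unitmx.
Qed.

Lemma gk_tr_Q_b : (0 < n)%N -> (cols n q)^T *m b = beta 1%N *: std_e1 R n.
Proof.
move=> n0; have -> : b = beta 1%N *: q 1%N.
  by rewrite (gk_q1 hrun) scalerA mulfV ?scale1r // (gk_beta_neq0 hrun).
rewrite -scalemxAr; congr (_ *: _); apply/matrixP => i j.
by rewrite (ord1 j) tr_cols_mul (gk_q_dot hrun) ?ltn_ord // mxE eqSS.
Qed.

(** The first block row gives M u = - A p = - A Q (Q^T p) = - M V B (Q^T p), which
    determines c.  Multiplying A^T V c = b by Q^T turns the second block row into
    B^T L^T c = beta_1 e_1. *)
Lemma gk_primal (u : 'cV[R]_m) (p : 'cV[R]_n) : (0 < n)%N ->
  M *m u + A *m p = 0 -> A^T *m u = b ->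
  exists2 c, u = Vmx v n *m c & (Lmx M v n)^T *m c = gk_x alpha beta n.
Proof.
move=> n0 Mu Au; pose c := - (Bmx alpha beta n *m ((cols n q)^T *m p)).
have uc : u = Vmx v n *m c.
  apply: (can_inj (mulKmx (posdef_unitmx hM))).
  rewrite /c !mulmxN !mulmxA -(gk_AQ hM hrun) -(mulmxA A).
  by rewrite (mulmx1C gk_Q_orthogonal) mulmx1; apply/eqP; rewrite -addr_eq0 Mu.
exists c => //.
have Bu : (Bmx alpha beta n)^T \in unitmx by rewrite unitmx_tr gk_B_unitmx.
apply: (can_inj (mulKmx Bu)); rewrite tr_Bmx_gk_x -gk_tr_Q_b // -Au uc !mulmxA.
have LB : Lmx M v n *m Bmx alpha beta n = (Vmx v n)^T *m (A *m cols n q).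
  by rewrite (gk_AQ hM hrun) /Lmx !mulmxA.
by rewrite -trmx_mul LB !trmx_mul trmxK.
Qed.

End FullRun.

(** * Splitting the indices into head and tail *)

Lemma sum_indicator (R : pzSemiRingType) (k n : nat) (f : 'I_k -> 'I_n)
    (i : 'I_n) : injective f ->
  \sum_l (f l == i)%:R = (i \in codom f)%:R :> R.
Proof.
move=> fI; case: (boolP (i \in codom f)) => [/codomP [l0 ->]|fi].
  rewrite (bigD1 l0) //= eqxx big1 ?addr0 // => l ll0.
  by rewrite (inj_eq fI) (negPf ll0).
rewrite big1 // => l _; case: eqP => // e.
by rewrite -e codom_f in fi.
Qed.

(** Left multiplication by this matrix selects the rows f 0, f 1, ...; right
    multiplication by its transpose selects the corresponding columns. *)
Definition selmx (R : pzSemiRingType) (k n : nat) (f : 'I_k -> 'I_n) : 'M[R]_(k, n) :=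
  rowsub f 1%:M.

(** The Gram matrix is the diagonal 0-1 matrix of the image of f. *)
Lemma selmx_gram (R : comNzRingType) (k n : nat) (f : 'I_k -> 'I_n) (i j : 'I_n) :
  injective f ->
  ((selmx R f)^T *m selmx R f) i j = ((i == j) && (i \in codom f))%:R.
Proof.
move=> fI; rewrite mxE; have [<-|ij] := eqVneq i j.
  rewrite -(sum_indicator R i fI); apply: eq_bigr => l _; rewrite !mxE.
  by case: eqP; rewrite ?mulr1 ?mulr0.
apply: big1 => l _; rewrite !mxE; case: eqP => [->|_]; last by rewrite mul0r.
by rewrite (negPf ij) mulr0.
Qed.

Lemma selmx_orth (R : comNzRingType) (k n : nat) (f : 'I_k -> 'I_n) :
  injective f -> selmx R f *m (selmx R f)^T = 1%:M.
Proof.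
move=> fI; rewrite -rowsubE; apply/matrixP => i j.
by rewrite !mxE (inj_eq fI) eq_sym.
Qed.

Lemma mxsub_selmx (R : comNzRingType) (k l n : nat) (f : 'I_k -> 'I_n)
    (g : 'I_l -> 'I_n) (X : 'M[R]_n) :
  mxsub f g X = selmx R f *m X *m (selmx R g)^T.
Proof.
rewrite -rowsubE trmx_mxsub trmx1 mulmx_colsub mulmx1.
by apply/matrixP => i j; rewrite !mxE.
Qed.

(** H selects the head and P the tail of a vector.  The hypothesis H L P^T = 0
    says that L is block lower triangular, so the last rows of L^T do not see the
    head of a vector.  Hence L^T d = P^T P x, where P d solves the tail system, and
    d^T L d = (L^T d)^T d = (P x)^T (P d). *)
Lemma tail_energy (F : fieldType) (k l n : nat) (H : 'M[F]_(k, n))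
    (P : 'M[F]_(l, n)) (L : 'M[F]_n) (c x : 'cV[F]_n) (z : 'cV[F]_k) :
    H^T *m H + P^T *m P = 1%:M -> P *m P^T = 1%:M -> H *m L *m P^T = 0 ->
    P *m L *m P^T \in unitmx ->
    L^T *m c = x -> (H *m L *m H^T)^T *m z = H *m x ->
  let d := c - H^T *m z in
  d^T *m L *m d = (P *m x)^T *m (invmx (P *m L *m P^T))^T *m (P *m x).
Proof.
move=> HP PP HLP Lu Lc Lz d.
have HLPt : P *m L^T *m H^T = 0.
  by apply: trmx_inj; rewrite !trmx_mul !trmxK mulmxA HLP trmx0.
have Ld : L^T *m d = P^T *m (P *m x).
  rewrite mulmxBr Lc.
  have -> : L^T *m (H^T *m z) = H^T *m (H *m x).
    rewrite -Lz -[LHS]mul1mx -HP mulmxDl -!mulmxA.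
    rewrite [P *m (L^T *m _)]mulmxA [P *m L^T *m _]mulmxA HLPt mul0mx mulmx0 addr0.
    by rewrite !trmx_mul trmxK -!mulmxA.
  by rewrite -{1}[x]mul1mx -HP mulmxDl -!mulmxA addrC addKr.
have LPd : (P *m L *m P^T)^T *m (P *m d) = P *m x.
  transitivity (P *m L^T *m d); last by rewrite -mulmxA Ld mulmxA PP mul1mx.
  rewrite -[in RHS](mul1mx d) -HP mulmxDl mulmxDr -[H^T *m H *m d]mulmxA.
  by rewrite [_ *m (H^T *m _)]mulmxA HLPt mul0mx add0r !trmx_mul trmxK !mulmxA.
have Lut : (P *m L *m P^T)^T \in unitmx by rewrite unitmx_tr.
have Pd : P *m d = (invmx (P *m L *m P^T))^T *m (P *m x).
  by rewrite -LPd trmx_inv mulKmx.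
have -> : d^T *m L = (L^T *m d)^T by rewrite trmx_mul trmxK.
by rewrite Ld (trmx_mul P^T) trmxK -(mulmxA _ P) Pd; apply: mulmxA.
Qed.

Lemma tail_ord_inj (n k : nat) : injective (@tail_ord n k).
Proof. by move=> i j /(congr1 val) /= /addnI /val_inj. Qed.

Lemma head_tail_cover (R : comNzRingType) (k n : nat) (kn : (k <= n)%N) :
  (selmx R (widen_ord kn))^T *m selmx R (widen_ord kn)
  + (selmx R (@tail_ord n k))^T *m selmx R (@tail_ord n k) = 1%:M.
Proof.
have hI : injective (widen_ord kn) by move=> i j [/val_inj].
have tI := @tail_ord_inj n k.
apply/matrixP => i j; rewrite mxE !selmx_gram // [RHS]mxE.
case: eqP => _; rewrite ?addr0 //=.
have -> : (i \in codom (widen_ord kn)) = (i < k)%N.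
  apply/codomP/idP => [[l ->]|ik]; first by rewrite /= ltn_ord.
  by exists (Ordinal ik); apply: val_inj.
have -> : (i \in codom (@tail_ord n k)) = (k <= i)%N.
  apply/codomP/idP => [[l ->]|ki]; first exact: leq_addr.
  have lt : (i - k < n - k)%N by rewrite ltn_sub2r // (leq_ltn_trans ki).
  by exists (Ordinal lt); apply: val_inj; rewrite /= subnKC.
by case: ltnP => _; rewrite ?addr0 ?add0r.
Qed.

(** * The error formula *)

Theorem mainTheorem4 (R : realType) (m n : nat)
    (M : 'M[R]_m) (A : 'M[R]_(m, n)) (b : 'cV[R]_n)
    (alpha beta : nat -> R) (q : nat -> 'cV[R]_n) (v : nat -> 'cV[R]_m)
    (u : 'cV[R]_m) (p : 'cV[R]_n) (k : nat)
    (hM : posdef M)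
    (hA : \rank A = n)
    (hb : b != 0)
    (hrun : gk_runs M A b alpha beta q v n)
    (hup : block_mx M A A^T 0 *m col_mx u p = col_mx 0 b)
    (hk1 : (1 <= k)%N) (hkn : (k < n)%N) :
  let e := u - gk_u M alpha beta v k in
  let x := tail_col k (gk_x alpha beta n) in
  let L := tail_block k (Lmx M v n) in
  energy_norm M e = Num.sqrt ((x^T *m invtrmx L *m x) 0 0).
Proof.
move=> e x L.
have kn := ltnW hkn; pose h := widen_ord kn; pose t := @tail_ord n k.
have [Mu Au] : M *m u + A *m p = 0 /\ A^T *m u = b.
  by move: hup; rewrite mul_block_col mul0mx addr0 => /eq_col_mx [].
have [c uc Lc] := gk_primal hM hA hrun (leq_ltn_trans (leq0n k) hkn) Mu Au.
have Ltrig := gk_L_trig hM hA hrun.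
have sub_unit l (f : 'I_l -> 'I_n) : {homo f : i j / (i < j)%N} ->
    mxsub f f (Lmx M v n) \in unitmx.
  move=> fmono; apply: trig_unitmx => [|i]; last first.
    by rewrite mxE (gk_L_diag hM hA hrun) oner_eq0.
  by apply/is_trig_mxP => i j ij; rewrite mxE (is_trig_mxP Ltrig) ?fmono.
have Vh : Vmx v k = Vmx v n *m (selmx R h)^T.
  rewrite trmx_mxsub trmx1 mulmx_colsub mulmx1.
  by apply/matrixP => i j; rewrite !mxE.
have Lh : Lmx M v k = selmx R h *m Lmx M v n *m (selmx R h)^T.
  by rewrite /Lmx Vh trmx_mul trmxK !mulmxA.
have Bh : Bmx alpha beta k = mxsub h h (Bmx alpha beta n).
  by apply/matrixP => i j; rewrite !mxE.
have Lku : Lmx M v k \in unitmx by rewrite Lh -mxsub_selmx sub_unit.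
have Bku : Bmx alpha beta k \in unitmx.
  rewrite -unitmx_tr; apply: trig_unitmx (Bmx_tr_trig _ _ _) _ => i.
  rewrite !mxE eqxx (gk_alpha_neq0 hM hA hrun) //=.
  exact: leq_trans (ltn_ord i) kn.
have Bkt : (Bmx alpha beta k)^T \in unitmx by rewrite unitmx_tr.
have Lkt : (Lmx M v k)^T \in unitmx by rewrite unitmx_tr.
have cover := head_tail_cover R kn; rewrite -/h -/t in cover.
(* The head of x_n is x_k: B^T is lower triangular, so its first k rows act on
   the head only. *)
have xh : beta 1%N *: (invtrmx (Bmx alpha beta k) *m std_e1 R k)
          = selmx R h *m gk_x alpha beta n.
  apply: (can_inj (mulKmx Bkt)).
  rewrite -scalemxAr mulmxA /invtrmx trmx_inv mulmxV // mul1mx.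
  have -> : beta 1%N *: std_e1 R k = selmx R h *m (beta 1%N *: std_e1 R n).
    by rewrite -rowsubE; apply/matrixP => i j; rewrite !mxE.
  rewrite -(tr_Bmx_gk_x hM hA hrun) Bh mxsub_selmx !trmx_mul trmxK.
  rewrite -[in LHS](mul1mx (gk_x _ _ _)) -cover mulmxDl !mulmxDr !mulmxA.
  have -> : selmx R h *m (Bmx alpha beta n)^T *m (selmx R t)^T = 0.
    rewrite -mxsub_selmx; apply/matrixP => i j.
    by rewrite mxE (is_trig_mxP (Bmx_tr_trig _ _ _)) ?mxE //= ltn_addr.
  by rewrite !mul0mx addr0.
have hLt : selmx R h *m Lmx M v n *m (selmx R t)^T = 0.
  rewrite -mxsub_selmx; apply/matrixP => i j.
  by rewrite mxE (is_trig_mxP Ltrig) ?mxE //= ltn_addr.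
have Lu : selmx R t *m Lmx M v n *m (selmx R t)^T \in unitmx.
  by rewrite -mxsub_selmx sub_unit // => i j ij; rewrite ltn_add2l.
have Lz : (selmx R h *m Lmx M v n *m (selmx R h)^T)^T *m gk_z M alpha beta v k
          = selmx R h *m gk_x alpha beta n.
  rewrite -Lh -xh /gk_z -scalemxAr -!mulmxA; congr (_ *: _).
  by rewrite {1}/invtrmx trmx_inv mulKVmx.
have ed : e = Vmx v n *m (c - (selmx R h)^T *m gk_z M alpha beta v k).
  by rewrite mulmxBr /e /gk_u uc Vh mulmxA.
have eMe d : (Vmx v n *m d)^T *m M *m (Vmx v n *m d)
             = d^T *m Lmx M v n *m d by rewrite trmx_mul !mulmxA.
rewrite /energy_norm ed eMe.
rewrite (tail_energy cover (selmx_orth R (@tail_ord_inj n k)) hLt Lu Lc Lz).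
by rewrite /x /L /tail_block mxsub_selmx /tail_col rowsubE.
Qed.
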